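(* Let $F$ be a field and let $m$ be a natural number. The Leavitt algebra $L_F(1,m)$ is isomorphic to the subalgebra of $\operatorname{M}_{\text{rc-fin}}(F)$ composed of the rectangular $m^\infty$-recurrent matrices.
   Context: The Leavitt algebra $L_F(1,m)$ is the unital $F$-algebra with generators $x_0,\dots,x_{m-1},y_0,\dots,y_{m-1}$ and relations $y_ix_j=\delta_{ij}$ for all $i,j$ and $\sum_i x_iy_i=1$. $\operatorname{M}_{\text{rc-fin}}(F)$ is the algebra of row- and column-finite matrices over $F$, i.e. infinite matrices with rows and columns indexed by $\{0,1,2,\dots\}$ in which every row and every column has finitely many nonzero entries. A matrix $x\in\operatorname{M}_{\text{rc-fin}}(F)$ is called rectangular $m^\infty$-recurrent if there are natural divisors $m^i,m^j$ of the supernatural number $m^\infty$ (with $i,j\ge 0$) and a rectangular matrix $a\in\operatorname{M}_{m^i\times m^j}(F)$ such that $x=a\oplus a\oplus\cdots$, i.e. $x$ consists of consecutive $m^i\times m^j$ blocks all equal to $a$ (the $k$-th block, $k\ge 0$, occupying rows $km^i,\dots,(k+1)m^i-1$ and columns $km^j,\dots,(k+1)m^j-1$), and zeros elsewhere.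
   Formalization: m is taken to be at least 2 (for m = 1 the recurrent matrices are only the scalars while L_F(1,1) = F[x,1/x]; m = 0 also fails), and the subalgebra is the set of finite sums of recurrent matrices, since these are not closed under addition. *)

(* Defs.v *)
From HB Require Import structures.
From mathcomp Require Import all_boot all_order all_algebra.
From mathcomp Require Import boolp classical_sets cardinality functions fsbigop.
From mathcomp Require Import monalg.

Set Implicit Arguments.
Unset Strict Implicit.
Unset Printing Implicit Defensive.

Import GRing.Theory.
Local Open Scope ring_scope.
Local Open Scope quotient_scope.

Inductive ideal_gen (R : nzRingType) (S : R -> Prop) : R -> Prop :=
| ideal_gen_mem a : S a -> ideal_gen S a
| ideal_gen0 : ideal_gen S 0
| ideal_genD a b : ideal_gen S a -> ideal_gen S b -> ideal_gen S (a + b)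
| ideal_genMl a b : ideal_gen S b -> ideal_gen S (a * b)
| ideal_genMr a b : ideal_gen S a -> ideal_gen S (a * b).

Section TwoSidedQuotient.
Variables (F : fieldType) (R : lalgType F) (S : R -> Prop).

Definition ideal_pred : {pred R} := fun x => `[< ideal_gen S x >].

Lemma ideal_predE x : (x \in ideal_pred) = `[< ideal_gen S x >].
Proof. by []. Qed.

Lemma ideal_zmod_closed : zmod_closed ideal_pred.
Proof.
split; first by apply/asboolP; apply: ideal_gen0.
move=> x y /asboolP Ix /asboolP Iy; apply/asboolP; apply: ideal_genD => //.
by rewrite -mulN1r; apply: ideal_genMl.
Qed.
HB.instance Definition _ := GRing.isZmodClosed.Build R ideal_pred
  ideal_zmod_closed.

(* [ring_quotient] only builds the ring structure for commutative rings, hence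
   the multiplication is put by hand on its additive quotient.  Since the
   generated ideal need not be proper, the quotient is a possibly trivial
   ring.  *)
Definition quot_gen := Quotient.quot ideal_pred.
HB.instance Definition _ := Choice.on quot_gen.
HB.instance Definition _ := GRing.Zmodule.on quot_gen.
HB.instance Definition _ := EqQuotient.on quot_gen.

Definition to_quot (x : R) : quot_gen := \pi_(Quotient.quot ideal_pred) x.

Definition quot_one : quot_gen := to_quot 1.
Definition quot_mul (u v : quot_gen) : quot_gen := to_quot (repr u * repr v).
Definition quot_scale (c : F) (u : quot_gen) : quot_gen :=
  to_quot (c *: repr u).

Lemma to_quotP x y : reflect (to_quot x = to_quot y) (x - y \in ideal_pred).
Proof. by rewrite Quotient.idealrBE; apply: eqP. Qed.

Lemma to_quotK u : to_quot (repr u) = u.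
Proof. exact: reprK. Qed.

Lemma to_quotD x y : to_quot (x + y) = to_quot x + to_quot y.
Proof. by rewrite /to_quot Quotient.pi_add. Qed.

Lemma to_quotM x y : to_quot (x * y) = quot_mul (to_quot x) (to_quot y).
Proof.
apply/to_quotP; set x' := repr _; set y' := repr _.
have Ix : x - x' \in ideal_pred by apply/to_quotP; rewrite to_quotK.
have Iy : y - y' \in ideal_pred by apply/to_quotP; rewrite to_quotK.
have -> : x * y - x' * y' = (x - x') * y + x' * (y - y').
  by rewrite mulrBl mulrBr addrA subrK.
apply/asboolP; apply: ideal_genD.
  by apply: ideal_genMr; apply/asboolP.
by apply: ideal_genMl; apply/asboolP.
Qed.

Lemma to_quotZ c x : to_quot (c *: x) = quot_scale c (to_quot x).
Proof.
apply/to_quotP; rewrite -scalerBr -mulr_algl.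
by apply/asboolP; apply: ideal_genMl; apply/asboolP/to_quotP; rewrite to_quotK.
Qed.

Lemma quot_mulA : associative quot_mul.
Proof.
move=> u v w; rewrite -[u]to_quotK -[v]to_quotK -[w]to_quotK.
by rewrite -!to_quotM mulrA.
Qed.

Lemma quot_mul1l : left_id quot_one quot_mul.
Proof. by move=> u; rewrite -[u]to_quotK -to_quotM mul1r. Qed.

Lemma quot_mul1r : right_id quot_one quot_mul.
Proof. by move=> u; rewrite -[u]to_quotK -to_quotM mulr1. Qed.

Lemma quot_mulDl : left_distributive quot_mul +%R.
Proof.
move=> u v w; rewrite -[u]to_quotK -[v]to_quotK -[w]to_quotK.
by rewrite -to_quotD -!to_quotM -to_quotD mulrDl.
Qed.

Lemma quot_mulDr : right_distributive quot_mul +%R.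
Proof.
move=> u v w; rewrite -[u]to_quotK -[v]to_quotK -[w]to_quotK.
by rewrite -to_quotD -!to_quotM -to_quotD mulrDr.
Qed.

HB.instance Definition _ := GRing.Zmodule_isPzRing.Build quot_gen
  quot_mulA quot_mul1l quot_mul1r quot_mulDl quot_mulDr.

Lemma quot_scaleA a b u :
  quot_scale a (quot_scale b u) = quot_scale (a * b) u.
Proof. by rewrite -[u]to_quotK -!to_quotZ scalerA. Qed.

Lemma quot_scale1 : left_id 1 quot_scale.
Proof. by move=> u; rewrite -[u]to_quotK -to_quotZ scale1r. Qed.

Lemma quot_scaleDr : right_distributive quot_scale +%R.
Proof.
move=> a u v; rewrite -[u]to_quotK -[v]to_quotK.
by rewrite -to_quotD -!to_quotZ -to_quotD scalerDr.
Qed.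

Lemma quot_scaleDl u : {morph quot_scale^~ u : a b / a + b}.
Proof.
by move=> a b /=; rewrite -[u]to_quotK -!to_quotZ -to_quotD scalerDl.
Qed.

HB.instance Definition _ := GRing.Zmodule_isLmodule.Build F quot_gen
  quot_scaleA quot_scale1 quot_scaleDr quot_scaleDl.

End TwoSidedQuotient.

Section Leavitt.
Variables (F : fieldType) (m : nat).

(* The free unital associative algebra on the 2m letters x_i := inl i and
   y_i := inr i, as the algebra of the free monoid on these letters.  *)
Definition leavitt_free : lalgType F := {malg F[{fmonom ('I_m + 'I_m)%type}]}.

Definition free_x (i : 'I_m) : leavitt_free := << fmu (inl i) >>.
Definition free_y (i : 'I_m) : leavitt_free := << fmu (inr i) >>.

Inductive leavitt_rel : leavitt_free -> Prop :=
| leavitt_rel_yx (i j : 'I_m) :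
    leavitt_rel (free_y i * free_x j - (i == j)%:R)
| leavitt_rel_xy :
    leavitt_rel (\sum_(i < m) free_x i * free_y i - 1).

Definition leavitt := quot_gen leavitt_rel.
HB.instance Definition _ := GRing.PzRing.on leavitt.
HB.instance Definition _ := GRing.Lmodule.on leavitt.

End Leavitt.

Section RowColumnFinite.
Variable F : fieldType.

Definition rcfin : {pred nat -> nat -> F} := fun x =>
  `[< (forall i, finite_set [set j | x i j != 0]%classic) /\
      (forall j, finite_set [set i | x i j != 0]%classic) >].

Lemma finite_nat_bound (f : nat -> F) :
  finite_set [set j | f j != 0]%classic <->
  exists n, forall j, (n <= j)%N -> f j = 0.
Proof.
split=> [/finite_seqP[s sE]|[n fn]].
  exists (\max_(i <- s) i).+1 => j; rewrite ltnNge => /negP jn.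
  apply/eqP/negPn/negP => fj; apply: jn.
  have js : j \in s by have : [set` s]%classic j by rewrite -sE.
  by apply: (leq_bigmax_seq (F := id)).
apply: (@sub_finite_set _ _ [set` iota 0 n]%classic) => [j /= fj|].
  rewrite mem_iota /= add0n ltnNge; apply: contra fj => /fn ->.
  by rewrite eqxx.
exact: finite_seq.
Qed.

Lemma rcfinP (x : nat -> nat -> F) :
  x \in rcfin <->
  (forall i, exists n, forall j, (n <= j)%N -> x i j = 0) /\
  (forall j, exists n, forall i, (n <= i)%N -> x i j = 0).
Proof.
split=> [/asboolP[rx cx]|[rx cx]].
  by split=> i; apply/(finite_nat_bound _).1; [apply: rx|apply: cx].
apply/asboolP; split=> i; [apply: (finite_nat_bound (x i)).2 => //|].
exact: (finite_nat_bound (x ^~ i)).2.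
Qed.

Lemma rcfin_zmod_closed : zmod_closed rcfin.
Proof.
split; first by apply/rcfinP; split=> i; exists 0%N.
move=> x y /rcfinP[rx cx] /rcfinP[ry cy]; apply/rcfinP.
split=> i.
  have [n xn] := rx i; have [p yp] := ry i; exists (maxn n p) => j.
  rewrite geq_max => /andP[nj pj].
  by change (x i j - y i j = 0); rewrite xn // yp // subrr.
have [n xn] := cx i; have [p yp] := cy i; exists (maxn n p) => j.
rewrite geq_max => /andP[nj pj].
by change (x j i - y j i = 0); rewrite xn // yp // subrr.
Qed.
HB.instance Definition _ := GRing.isZmodClosed.Build (nat -> nat -> F) rcfin
  rcfin_zmod_closed.

Record rcmx := RCMx { rcval :> nat -> nat -> F; _ : rcval \in rcfin }.
HB.instance Definition _ := [isSub for rcval].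
HB.instance Definition _ := [Choice of rcmx by <:].
HB.instance Definition _ := [SubChoice_isSubZmodule of rcmx by <:].

Implicit Types x y z : rcmx.

Lemma rcmxP x y : (forall i j, x i j = y i j) -> x = y.
Proof.
by move=> xy; apply: val_inj; apply/funext => i; apply/funext => j; apply: xy.
Qed.

Lemma rcmx_row x i : exists n, forall j, (n <= j)%N -> x i j = 0.
Proof. by case: x => x /= /rcfinP[rx _]; apply: rx. Qed.

Lemma rcmx_col x j : exists n, forall i, (n <= i)%N -> x i j = 0.
Proof. by case: x => x /= /rcfinP[_ cx]; apply: cx. Qed.

Lemma rcmx_rows x n : exists p,
  forall i j, (i < n)%N -> (p <= j)%N -> x i j = 0.
Proof.
elim: n => [|n [p xp]]; first by exists 0%N.
have [q xq] := rcmx_row x n; exists (maxn p q) => i j.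
rewrite geq_max ltnS leq_eqVlt => /orP[/eqP ->|lin] /andP[pj qj].
  exact: xq.
exact: xp.
Qed.

Lemma rcmx_cols x n : exists p,
  forall i j, (j < n)%N -> (p <= i)%N -> x i j = 0.
Proof.
elim: n => [|n [p xp]]; first by exists 0%N.
have [q xq] := rcmx_col x n; exists (maxn p q) => i j.
rewrite geq_max ltnS leq_eqVlt => /orP[/eqP ->|lin] /andP[pj qj].
  exact: xq.
exact: xp.
Qed.

Lemma fsum_bound n (f : nat -> F) : (forall j, (n <= j)%N -> f j = 0) ->
  \sum_(j \in [set: nat]%classic) f j = \sum_(j < n) f j.
Proof.
move=> fn; rewrite -(big_mkord xpredT f) /index_iota subn0.
rewrite (fsbig_seq _ f (iota_uniq 0 n)); apply/esym/fsbig_widen => //.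
move=> j /= [_ /negP]; rewrite mem_iota /= add0n -leqNgt; exact: fn.
Qed.

Definition rc_mul x y : nat -> nat -> F := fun i k =>
  \sum_(j \in [set: nat]%classic) x i j * y j k.

Lemma rc_mulE x y i k n : (forall j, (n <= j)%N -> x i j = 0) ->
  rc_mul x y i k = \sum_(j < n) x i j * y j k.
Proof. by move=> xn; apply: fsum_bound => j /xn ->; rewrite mul0r. Qed.

Lemma rc_mul_proof x y : rc_mul x y \in rcfin.
Proof.
apply/rcfinP; split=> i.
  have [n xn] := rcmx_row x i; have [p yp] := rcmx_rows y n.
  exists p => k pk; rewrite (rc_mulE _ _ xn) big1 // => j _.
  by rewrite yp ?mulr0.
have [n yn] := rcmx_col y i; have [p xp] := rcmx_cols x n.
exists p => k pk; apply: fsbig1 => j _.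
have [nj|jn] := leqP n j; first by rewrite yn ?mulr0.
by rewrite xp ?mul0r.
Qed.
Definition rcmx_mul x y : rcmx := RCMx (rc_mul_proof x y).

Lemma rc_one_proof : (fun i j => (i == j)%:R : F) \in rcfin.
Proof.
by apply/rcfinP; split=> i; exists i.+1 => j ij;
  rewrite ?(ltn_eqF ij) ?(gtn_eqF ij).
Qed.
Definition rcmx_one : rcmx := RCMx rc_one_proof.

Lemma rc_scale_proof (c : F) x : (fun i j => c * x i j) \in rcfin.
Proof.
apply/rcfinP; split=> i.
  by have [n xn] := rcmx_row x i; exists n => j /xn ->; rewrite mulr0.
by have [n xn] := rcmx_col x i; exists n => j /xn ->; rewrite mulr0.
Qed.
Definition rcmx_scale c x : rcmx := RCMx (rc_scale_proof c x).

Lemma rcmxD x y i j : (x + y) i j = x i j + y i j. Proof. by []. Qed.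
Lemma rcmx0 i j : (0 : rcmx) i j = 0. Proof. by []. Qed.

Lemma rcmx_mulA : associative rcmx_mul.
Proof.
move=> x y z; apply: rcmxP => i l /=.
have [n xn] := rcmx_row x i; have [p yp] := rcmx_rows y n.
rewrite (rc_mulE _ _ xn) (@rc_mulE _ _ _ _ p) => [|j pj]; last first.
  rewrite /= (rc_mulE _ _ xn) big1 // => k _.
  by rewrite yp ?mulr0.
under eq_bigr => j _.
  rewrite /= (@rc_mulE _ _ _ _ p) => [|k pk]; last exact: yp.
  rewrite big_distrr; over.
rewrite exchange_big /=; apply: eq_bigr => k _.
rewrite (rc_mulE _ _ xn) big_distrl /=.
by apply: eq_bigr => j _; rewrite mulrA.
Qed.

Lemma rcmx_mul1l : left_id rcmx_one rcmx_mul.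
Proof.
move=> x; apply: rcmxP => i l /=.
rewrite (@rc_mulE _ _ _ _ i.+1) => [|j ij]; last by rewrite /= (ltn_eqF ij).
rewrite (bigD1 ord_max) //= eqxx mul1r big1 ?addr0 // => j.
by rewrite -val_eqE /= eq_sym => /negPf ->; rewrite mul0r.
Qed.

Lemma rcmx_mul1r : right_id rcmx_one rcmx_mul.
Proof.
move=> x; apply: rcmxP => i l /=.
rewrite /rc_mul (@fsum_bound l.+1) => [|j lj]; last first.
  by rewrite /= (gtn_eqF lj) mulr0.
rewrite (bigD1 ord_max) //= eqxx mulr1 big1 ?addr0 // => j.
by rewrite -val_eqE /= => /negPf ->; rewrite mulr0.
Qed.

Lemma rcmx_mulDl : left_distributive rcmx_mul +%R.
Proof.
move=> x y z; apply: rcmxP => i l.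
have [n xn] := rcmx_row x i; have [p yp] := rcmx_row y i.
have xq j : (maxn n p <= j)%N -> x i j = 0.
  by rewrite geq_max => /andP[/xn].
have yq j : (maxn n p <= j)%N -> y i j = 0.
  by rewrite geq_max => /andP[_ /yp].
rewrite rcmxD /= (rc_mulE _ _ xq) (rc_mulE _ _ yq) (@rc_mulE _ _ _ _ (maxn n p)).
  by rewrite -big_split; apply: eq_bigr => j _; rewrite rcmxD mulrDl.
by move=> j jq; rewrite rcmxD xq // yq // addr0.
Qed.

Lemma rcmx_mulDr : right_distributive rcmx_mul +%R.
Proof.
move=> x y z; apply: rcmxP => i l.
have [n xn] := rcmx_row x i.
rewrite rcmxD /= !(rc_mulE _ _ xn) -big_split.
by apply: eq_bigr => j _; rewrite rcmxD mulrDr.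
Qed.

Lemma rcmx_one_neq0 : rcmx_one != 0.
Proof.
apply/eqP => /(congr1 (fun x : rcmx => x 0%N 0%N)).
by rewrite rcmx0 => /eqP; rewrite oner_eq0.
Qed.

HB.instance Definition _ := GRing.Zmodule_isNzRing.Build rcmx
  rcmx_mulA rcmx_mul1l rcmx_mul1r rcmx_mulDl rcmx_mulDr rcmx_one_neq0.

Lemma rcmx_scaleA a b x : rcmx_scale a (rcmx_scale b x) = rcmx_scale (a * b) x.
Proof. by apply: rcmxP => i j /=; rewrite mulrA. Qed.

Lemma rcmx_scale1 : left_id 1 rcmx_scale.
Proof. by move=> x; apply: rcmxP => i j /=; rewrite mul1r. Qed.

Lemma rcmx_scaleDr : right_distributive rcmx_scale +%R.
Proof. by move=> a x y; apply: rcmxP => i j; rewrite rcmxD -mulrDr. Qed.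

Lemma rcmx_scaleDl x : {morph rcmx_scale^~ x : a b / a + b}.
Proof. by move=> a b; apply: rcmxP => i j; rewrite rcmxD -mulrDl. Qed.

HB.instance Definition _ := GRing.Zmodule_isLmodule.Build F rcmx
  rcmx_scaleA rcmx_scale1 rcmx_scaleDr rcmx_scaleDl.

Lemma rcmx_mulE x y i k : (x * y) i k = rc_mul x y i k. Proof. by []. Qed.
Lemma rcmx_oneE i j : (1 : rcmx) i j = (i == j)%:R. Proof. by []. Qed.
Lemma rcmx_scaleE a x i j : (a *: x) i j = a * x i j. Proof. by []. Qed.

Lemma rcmx_scaleAl (a : F) x y : a *: (x * y) = a *: x * y.
Proof.
apply: rcmxP => i k; have [n xn] := rcmx_row x i.
rewrite rcmx_scaleE !rcmx_mulE (rc_mulE _ _ xn) (@rc_mulE _ _ _ _ n).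
  by rewrite big_distrr; apply: eq_bigr => j _; rewrite /= mulrA.
by move=> j /xn; rewrite rcmx_scaleE => ->; rewrite mulr0.
Qed.
HB.instance Definition _ := GRing.Lmodule_isLalgebra.Build F rcmx rcmx_scaleAl.

Lemma rcmx_scaleAr (a : F) x y : a *: (x * y) = x * (a *: y).
Proof.
apply: rcmxP => i k; have [n xn] := rcmx_row x i.
rewrite rcmx_scaleE !rcmx_mulE !(rc_mulE _ _ xn) big_distrr.
by apply: eq_bigr => j _; rewrite rcmx_scaleE [RHS]mulrCA.
Qed.
HB.instance Definition _ := GRing.Lalgebra_isAlgebra.Build F rcmx rcmx_scaleAr.

End RowColumnFinite.

Section Recurrent.
Variable F : fieldType.

(* x = a (+) a (+) ...  with a of size p x q *)
Definition repeated_block p q (a : 'M[F]_(p, q)) (x : rcmx F) : Prop :=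
  (forall k (u : 'I_p) (v : 'I_q), x (k * p + u)%N (k * q + v)%N = a u v) /\
  (forall r c, x r c != 0 -> exists k (u : 'I_p) (v : 'I_q),
     r = (k * p + u)%N /\ c = (k * q + v)%N).

Lemma block_uniq p k k' (u u' : 'I_p) :
  (k * p + u = k' * p + u')%N -> k = k' /\ u = u'.
Proof.
move=> e; have p0 : (0 < p)%N by case: p u {u' e} => // -[].
have kE : k = k'.
  have := congr1 (divn^~ p) e.
  by rewrite !divnMDl // !divn_small // !addn0.
by split=> //; apply/val_inj/(@addnI (k * p)%N); rewrite e kE.
Qed.

Lemma repeated_block0 p q : @repeated_block p q 0 0.
Proof. by split=> [k u v|r c]; rewrite ?mxE // rcmx0 eqxx. Qed.

Lemma repeated_block1 : @repeated_block 1 1 1%:M 1.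
Proof.
split=> [k u v|r c]; rewrite rcmx_oneE.
  by rewrite !ord1 mxE !eqxx.
have [-> _|_] := eqVneq r c; last by rewrite eqxx.
by exists c, ord0, ord0; rewrite muln1 addn0.
Qed.

Lemma repeated_blockZ p q a x c : @repeated_block p q a x ->
  repeated_block (c *: a) (c *: x).
Proof.
case=> xa x0; split=> [k u v|r s]; rewrite rcmx_scaleE ?mxE ?xa //.
by rewrite mulf_eq0 negb_or => /andP[_ /x0].
Qed.

Lemma repeated_block_row p q a x k (u : 'I_p) j : @repeated_block p q a x ->
  x (k * p + u)%N j != 0 -> exists v : 'I_q, j = (k * q + v)%N.
Proof.
by move=> [_ x0] /x0[k' [u' [v [/block_uniq[<- _] ->]]]]; exists v.
Qed.

Lemma fsum_block q k (f : nat -> F) :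
  (forall j, f j != 0 -> exists v : 'I_q, j = (k * q + v)%N) ->
  \sum_(j \in [set: nat]%classic) f j = \sum_(v < q) f (k * q + v)%N.
Proof.
move=> fq; rewrite (@fsum_bound _ (k * q + q)) => [|j jq]; last first.
  apply/eqP/negPn/negP => /fq[v jE].
  by move: jq; rewrite jE leq_add2l leqNgt ltn_ord.
rewrite big_split_ord /= big1 ?add0r // => j _.
apply/eqP/negPn/negP => /fq[v jE].
by have := ltn_ord j; rewrite jE ltnNge leq_addr.
Qed.

Lemma repeated_blockM p q s a b x y :
  @repeated_block p q a x -> @repeated_block q s b y ->
  repeated_block (a *m b) (x * y).
Proof.
move=> xa yb; split=> [k u v|r c xy0].
  rewrite mxE rcmx_mulE /rc_mul (@fsum_block q k) => [|j].
    by apply: eq_bigr => w _; rewrite xa.1 yb.1.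
  by rewrite mulf_eq0 negb_or => /andP[/(repeated_block_row xa)].
have [j /andP[xj yj]] : exists j, (x r j != 0) && (y j c != 0).
  apply: contrapT => xy; case/eqP: xy0; apply: fsbig1 => j _.
  have [->|xj] := eqVneq (x r j) 0; first by rewrite mul0r.
  have [->|yj] := eqVneq (y j c) 0; first by rewrite mulr0.
  by case: xy; exists j; rewrite xj yj.
have [k [u [w [-> jE]]]] := xa.2 _ _ xj.
move: yj; rewrite jE => /(repeated_block_row yb)[v ->].
by exists k, u, v.
Qed.

Lemma repeated_block_refine p q t a x : (0 < t)%N ->
  @repeated_block p q a x ->
  exists a' : 'M_(p * t, q * t), repeated_block a' x.
Proof.
move=> t0 [xa x0].
have blockP n (u : 'I_(n * t)) :
    exists k (w : 'I_n), (k < t)%N /\ u = (k * n + w)%N :> nat.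
  case: n u => [[]//|n u]; exists (u %/ n.+1)%N, (inord (u %% n.+1)).
  rewrite inordK ?ltn_mod // -divn_eq ltn_divLR //; split=> //.
  by rewrite [ltnRHS]mulnC ltn_ord.
have blockD n k k' w : (k * (n * t) + (k' * n + w) = (k * t + k') * n + w)%N.
  by rewrite mulnDl addnA -mulnA (mulnC t).
exists (\matrix_(u, v) x u v); split=> [k u v|r c /x0[k [u [v [-> ->]]]]].
  rewrite mxE; have [k1 [u1 [_ uE]]] := blockP p u.
  have [k2 [v1 [_ vE]]] := blockP q v; rewrite {}uE {}vE !blockD.
  have [->|/eqP k12] := eqVneq k1 k2; first by rewrite !xa.
  transitivity (0 : F); [|apply/esym]; apply/eqP/negPn/negP => /x0;
    move=> [k' [u' [v' [/block_uniq[e1 _] /block_uniq[e2 _]]]]]; apply: k12.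
    by apply/(@addnI (k * t)%N); rewrite e1 e2.
  by rewrite e1 e2.
have lt_block n (w : 'I_n) : ((k %% t) * n + w < n * t)%N.
  apply: (@leq_trans ((k %% t).+1 * n)).
    by rewrite mulSn addnC ltn_add2r ltn_ord.
  by rewrite mulnC leq_mul2l ltn_mod t0 orbT.
exists (k %/ t)%N, (Ordinal (lt_block p u)), (Ordinal (lt_block q v)).
by rewrite /= !blockD -divn_eq.
Qed.

Variable m : nat.

Definition recurrent (x : rcmx F) : Prop :=
  exists (i j : nat) (a : 'M[F]_(m ^ i, m ^ j)), repeated_block a x.

Lemma repeated_block_eq0 p q a x : @repeated_block p q a x ->
  p = 0%N \/ q = 0%N -> x = 0.
Proof.
move=> [_ x0] pq; apply: rcmxP => r c; rewrite rcmx0; apply/eqP/negPn/negP.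
by move=> /x0[_ [u [v _]]]; case: pq => e; [move: u|move: v]; rewrite e => -[].
Qed.

Lemma recurrent0 : recurrent 0.
Proof. by exists 0%N, 0%N, 0; apply: repeated_block0. Qed.

Lemma recurrentM x y : recurrent x -> recurrent y -> recurrent (x * y).
Proof.
move=> [i [j [a xa]]] [k [l [b yb]]].
have [mj|mj] := posnP (m ^ j)%N.
  rewrite (repeated_block_eq0 xa) ?mul0r; [exact: recurrent0|by right].
have [mk|mk] := posnP (m ^ k)%N.
  rewrite (repeated_block_eq0 yb) ?mulr0; [exact: recurrent0|by left].
have [a' {}xa] := repeated_block_refine mk xa.
have [b' {}yb] := repeated_block_refine mj yb.
exists (i + k)%N, (l + j)%N.
rewrite !expnD; move: a' xa b' yb; rewrite (mulnC (m ^ j)%N) => a' xa b' yb.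
by exists (a' *m b'); apply: repeated_blockM xa yb.
Qed.

(* For i1 - j1 <> i2 - j2 the sum of an m^i1 x m^j1 and an m^i2 x m^j2
   recurrent matrix is in general not recurrent, so the subalgebra is made of
   the finite sums of recurrent matrices.  No coefficients are needed, since
   recurrent matrices are closed under scaling.  *)
Definition rec_sums : {pred rcmx F} := fun x =>
  `[< exists s : seq (rcmx F),
        (forall y, y \in s -> recurrent y) /\ x = \sum_(y <- s) y >].

Lemma rec_sums_recurrent x : recurrent x -> x \in rec_sums.
Proof.
move=> rx; apply/asboolP; exists [:: x].
by split=> [y|]; rewrite ?big_seq1 // inE => /eqP ->.
Qed.

Lemma rec_sums0 : 0 \in rec_sums.
Proof. by apply/asboolP; exists [::]; rewrite big_nil. Qed.

Lemma rec_sumsD x y : x \in rec_sums -> y \in rec_sums -> x + y \in rec_sums.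
Proof.
move=> /asboolP[s [rs ->]] /asboolP[t [rt ->]]; apply/asboolP.
exists (s ++ t); rewrite big_cat; split=> // z.
by rewrite mem_cat => /orP[/rs|/rt].
Qed.

Lemma rec_sums_sum (I : eqType) (r : seq I) (G : I -> rcmx F) :
  (forall i, i \in r -> G i \in rec_sums) -> \sum_(i <- r) G i \in rec_sums.
Proof.
elim: r => [|i r IHr] rG; first by rewrite big_nil rec_sums0.
rewrite big_cons rec_sumsD ?rG ?mem_head // IHr // => j jr.
by rewrite rG // inE jr orbT.
Qed.

Lemma rec_sums_subalg_closed : GRing.subalg_closed rec_sums.
Proof.
split=> [|c x y /asboolP[s [rs ->]] sy|x y /asboolP[s [rs ->]]].
- apply: rec_sums_recurrent; exists 0%N, 0%N, 1%:M; exact: repeated_block1.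
- rewrite rec_sumsD // scaler_sumr rec_sums_sum // => z /rs [i [j [a za]]].
  by apply: rec_sums_recurrent; exists i, j, (c *: a); apply: repeated_blockZ.
- move=> /asboolP[t [rt ->]]; rewrite mulr_suml rec_sums_sum // => z /rs rz.
  rewrite mulr_sumr rec_sums_sum // => w /rt rw.
  by apply/rec_sums_recurrent/recurrentM.
Qed.
HB.instance Definition _ := GRing.isSubalgClosed.Build F (rcmx F) rec_sums
  rec_sums_subalg_closed.

Record rec_alg := RecAlg { rec_val :> rcmx F; _ : rec_val \in rec_sums }.
HB.instance Definition _ := [isSub for rec_val].
HB.instance Definition _ := [Choice of rec_alg by <:].
HB.instance Definition _ := [SubChoice_isSubAlgebra of rec_alg by <:].

Lemma rec_sums_min (A : subalgClosed (rcmx F)) :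
  (forall x, recurrent x -> x \in A) -> {subset rec_sums <= A}.
Proof.
move=> rA x /asboolP[s [rs ->]]; rewrite big_seq rpred_sum // => y /rs.
exact: rA.
Qed.

End Recurrent.

(* Main.v *)
From HB Require Import structures.
Require Import Defs.
From mathcomp Require Import all_boot all_order all_algebra.
From mathcomp Require Import boolp classical_sets finmap monalg.

Set Implicit Arguments.
Unset Strict Implicit.
Unset Printing Implicit Defensive.

Import GRing.Theory.
Local Open Scope ring_scope.

(* Let x_i and y_i act as the m x 1 and 1 x m recurrent matrices with a single
   1 in position i of the block.
   Surjectivity: for x with an m^(i+1) x m^j block, every y_k x has an
   m^i x m^j block, and x = sum_k x_k (y_k x); columns are reduced likewise.
   Injectivity: right multiplication of a by long enough words in the x_i sends
   a into the span of the words in the x_i, and a = sum_i (a x_i) y_i, so it is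
   enough to treat this span.  There the column of index 1 determines the
   element, since distinct words send the basis vector 1 to distinct basis
   vectors: the words are the base m expansions with leading digit 1. *)

(** * Scalars in monoid algebras *)

Lemma malg_scaleU (K : choiceType) (R : nzRingType) (c x : R) (k : K) :
  << c * x *g k >> = c *: << x *g k >> :> {malg R[K]}.
Proof. by apply/malgP => l; rewrite mcoeffZ !mcoeffU mulrnAr. Qed.

(** Commutativity of the coefficients lets a scalar pass the left factor; the quotient inherits this
    in [leavitt_scaleAr]. *)
Lemma malg_scaleAr (K : monomType) (R : comNzRingType) (c : R)
  (a b : {malg R[K]}) : c *: (a * b) = a * (c *: b).
Proof.
(* Both products are expanded over the supports of [a] and [b], since scaling cannot enlarge the
   support of [b]. *)
rewrite (malgMEw (fsubset_refl _) (msuppZ_le c b)) malgME scaler_sumr.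
apply: eq_bigr => k _; rewrite scaler_sumr; apply: eq_bigr => l _.
by rewrite -malg_scaleU mcoeffZ mulrCA.
Qed.

(** * The Leavitt algebra by generators and relations *)

Section LeavittPresentation.
Variables (F : fieldType) (m : nat).

Definition leavitt_class (a : leavitt_free F m) : leavitt F m :=
  to_quot (@leavitt_rel F m) a.
Definition leavitt_x (i : 'I_m) := leavitt_class (free_x F i).
Definition leavitt_y (i : 'I_m) := leavitt_class (free_y F i).

Lemma leavitt_classB : {morph leavitt_class : a b / a - b}.
Proof.
move=> a b; apply/esym/(canLR (addrK _)).
by rewrite -[RHS]to_quotD subrK.
Qed.

HB.instance Definition _ := GRing.isZmodMorphism.Build _ _ leavitt_class
  leavitt_classB.

Lemma leavitt_class_monoid : monoid_morphism leavitt_class.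
Proof. by split; [exact: (erefl (quot_one _))|exact: to_quotM]. Qed.

HB.instance Definition _ := GRing.isMonoidMorphism.Build _ _ leavitt_class
  leavitt_class_monoid.

HB.instance Definition _ := GRing.isScalable.Build F _ _ _ leavitt_class
  (to_quotZ (@leavitt_rel F m)).

Lemma leavitt_classP (z : leavitt F m) : exists a, z = leavitt_class a.
Proof. by exists (repr z); rewrite /leavitt_class to_quotK. Qed.

Lemma leavitt_class_rel a : leavitt_rel a -> leavitt_class a = 0.
Proof.
move=> ra; rewrite -(rmorph0 leavitt_class); apply/to_quotP.
by rewrite subr0; apply/asboolP/ideal_gen_mem.
Qed.

Lemma leavitt_yx i j : leavitt_y i * leavitt_x j = (i == j)%:R.
Proof.
apply/subr0_eq; rewrite -[RHS](leavitt_class_rel (leavitt_rel_yx F i j)).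
by rewrite rmorphB rmorphM rmorph_nat.
Qed.

Lemma leavitt_xy : \sum_i leavitt_x i * leavitt_y i = 1.
Proof.
apply/subr0_eq; rewrite -[RHS](leavitt_class_rel (leavitt_rel_xy F m)).
rewrite rmorphB rmorph1 rmorph_sum.
by apply: (congr1 (fun w => w - 1)); apply: eq_bigr => i _; rewrite rmorphM.
Qed.

Lemma leavitt_scaleAl (c : F) (u v : leavitt F m) : c *: (u * v) = c *: u * v.
Proof.
have [a ->] := leavitt_classP u; have [b ->] := leavitt_classP v.
by rewrite -linearZ -!rmorphM -linearZ scalerAl.
Qed.

Lemma leavitt_scaleAr (c : F) (u v : leavitt F m) : c *: (u * v) = u * (c *: v).
Proof.
have [a ->] := leavitt_classP u; have [b ->] := leavitt_classP v.
by rewrite -linearZ -!rmorphM -linearZ [c *: (a * b)]malg_scaleAr.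
Qed.

(** Every class is a linear combination of monomials, and a monomial is built from 1 by multiplying
    letters on the left. *)
Lemma leavitt_ind (P : leavitt F m -> Prop) :
  P 1 -> (forall u v, P u -> P v -> P (u + v)) ->
  (forall c u, P u -> P (c *: u)) ->
  (forall i u, P u -> P (leavitt_x i * u)) ->
  (forall i u, P u -> P (leavitt_y i * u)) ->
  forall u, P u.
Proof.
move=> P1 PD PZ Px Py u; have [a ->] := leavitt_classP u.
have P0 : P 0 by rewrite -(scale0r (1 : leavitt F m)); apply: PZ.
rewrite [a]monalgE rmorph_sum; elim/big_ind: _ => // k _.
rewrite -[a@_k]mulr1 malg_scaleU.
rewrite [X in P X](to_quotZ (@leavitt_rel F m)); apply: PZ.
rewrite -[k]fmK; elim: (k : seq _) => [|l s Ps]; first by rewrite -fmoneE.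
have -> : << FMonom (l :: s) >> =
    << fmu l >> * << FMonom s >> :> leavitt_free F m.
  rewrite [RHS]malgM_def fgmulUU mul1r; congr << _ >>; apply: val_inj.
  by rewrite /= fmM fmU.
rewrite [X in P X](to_quotM (@leavitt_rel F m)).
by case: l => i; [apply: Px|apply: Py].
Qed.

(** The universal property of the presentation: words are evaluated at [X] and [Y]; the linear
    extension kills the relators, hence the ideal they generate, and so descends to the quotient. *)
Lemma leavitt_lift (A : algType F) (X Y : 'I_m -> A) :
  (forall i j, Y i * X j = (i == j)%:R) -> \sum_i X i * Y i = 1 ->
  exists phi : {rmorphism leavitt F m -> A},
    [/\ scalable phi, forall i, phi (leavitt_x i) = X i &
        forall i, phi (leavitt_y i) = Y i].
Proof.
move=> YX XY.
pose h (k : {fmonom ('I_m + 'I_m)%type}) :=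
  \prod_(l <- k) match l with inl i => X i | inr i => Y i end.
have hM : mmorphism h.
  by split=> [k l|]; rewrite /h ?fmM ?fm1 ?big_nil ?big_cat.
pose hh : {mmorphism _ -> _} := HB.pack h (isMultiplicative.Build _ _ h hM).
(* Scalars are central in [A], which makes the evaluation multiplicative although [A] need not be
   commutative. *)
have commA (a : {malg F[{fmonom ('I_m + 'I_m)%type}]}) k l :
    GRing.comm (in_alg A a@_k) (hh l) by exact: comm_alg.
have [mM m1] := commr_mmap_is_multiplicative commA.
pose f := mmap (in_alg A) hh.
have fM (a b : leavitt_free F m) : f (a * b) = f a * f b by exact: mM.
have f1 : f (1 : leavitt_free F m) = 1 by exact: m1.
have fU c k : f << c *g k >> = c *: h k by rewrite /f mmapU mulr_algl.
have fZ c a : f (c *: a) = c *: f a by rewrite /f mmapZ mulr_algl.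
have fx i : f (free_x F i) = X i by rewrite fU scale1r /h fmU big_seq1.
have fy i : f (free_y F i) = Y i by rewrite fU scale1r /h fmU big_seq1.
have f0 : f 0 = 0 by exact: mmap0.
have fD a b : f (a + b) = f a + f b by exact: mmapD.
have fBE a b : f (a - b) = f a - f b by exact: mmapB.
have f_sum (G : 'I_m -> leavitt_free F m) : f (\sum_i G i) = \sum_i f (G i).
  exact: (big_morph f fD f0).
have f_nat (b : bool) : f b%:R = b%:R by case: b.
have fI a : ideal_gen (@leavitt_rel F m) a -> f a = 0.
  elim=> {a} [a| |a b _ fa _ fb|a b _ fb|a b _ fa].
  - case=> [i j|]; rewrite fBE.
      by rewrite fM fx fy YX f_nat subrr.
    rewrite f_sum f1 -[X in _ - X]XY; apply/eqP; rewrite subr_eq0; apply/eqP.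
    by apply: eq_bigr => i _; rewrite fM fx fy.
  - exact: f0.
  - by rewrite fD fa fb addr0.
  - by rewrite [LHS]fM [X in _ * X]fb mulr0.
  - by rewrite [LHS]fM [X in X * _]fa mul0r.
(* Since [f] vanishes on the ideal, its value does not depend on the chosen representative. *)
pose g (z : leavitt F m) := f (repr z).
have gE a : g (leavitt_class a) = f a.
  apply/subr0_eq; rewrite -fBE; apply: fI; apply/asboolP/to_quotP.
  by rewrite to_quotK.
have gB : zmod_morphism g.
  move=> u v; have [a ->] := leavitt_classP u; have [b ->] := leavitt_classP v.
  by rewrite -leavitt_classB !gE fBE.
have gM : monoid_morphism g.
  split=> [|u v]; first by rewrite -[RHS]f1 -gE.
  have [a ->] := leavitt_classP u; have [b ->] := leavitt_classP v.
  rewrite -[X in g X](to_quotM (@leavitt_rel F m)).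
  by rewrite [LHS]gE !gE [LHS]fM.
pose phi : {rmorphism leavitt F m -> A} := HB.pack g
  (GRing.isZmodMorphism.Build _ _ g gB) (GRing.isMonoidMorphism.Build _ _ g gM).
exists phi; split=> [c u|i|i] /=.
- have [a ->] := leavitt_classP u.
  rewrite -[X in g X](to_quotZ (@leavitt_rel F m)).
  by rewrite [LHS]gE gE fZ.
- by rewrite gE.
- by rewrite gE.
Qed.
End LeavittPresentation.

(** * Reduction of injectivity to the span of the words in the [x_i] *)

Section XWords.
Variables (F : fieldType) (m : nat).
Notation L := (leavitt F m).

Definition xword (u : seq 'I_m) : L := \prod_(i <- u) leavitt_x F i.

Inductive xspan : L -> Prop :=
| xspan_word u : xspan (xword u)
| xspanD a b : xspan a -> xspan b -> xspan (a + b)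
| xspanZ (c : F) a : xspan a -> xspan (c *: a).

(** This amounts to [a * xword u] lying in the span for every [u] of length [n]; taking one letter
    at a time suits induction on [n]. *)
Fixpoint xspan_right n (a : L) : Prop :=
  if n is p.+1 then forall i, xspan_right p (a * leavitt_x F i) else xspan a.

Lemma xspan_Mx a i : xspan a -> xspan (a * leavitt_x F i).
Proof.
elim=> {a} [u|a b _ IHa _ IHb|c a _ IHa].
- suff -> : xword u * leavitt_x F i = xword (rcons u i) by constructor.
  by rewrite /xword -cats1 big_cat big_seq1.
- by rewrite mulrDl; constructor.
- by rewrite -leavitt_scaleAl; constructor.
Qed.

Lemma xspan_right_leq n p a : (n <= p)%N -> xspan_right n a -> xspan_right p a.
Proof.
elim: p n a => [|p IHp] [|n] a //=.
  by move=> _ Xa i; apply: (IHp 0%N) => //; apply: xspan_Mx.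
by rewrite ltnS => np Xa i; apply: IHp np (Xa i).
Qed.

Lemma xspan_rightD n a b :
  xspan_right n a -> xspan_right n b -> xspan_right n (a + b).
Proof.
elim: n a b => [|n IHn] a b /= Xa Xb; first exact: xspanD.
by move=> i; rewrite mulrDl; apply: IHn.
Qed.

Lemma xspan_rightZ n c a : xspan_right n a -> xspan_right n (c *: a).
Proof.
elim: n a => [|n IHn] a /= Xa; first exact: xspanZ.
by move=> i; rewrite -leavitt_scaleAl; apply: IHn.
Qed.

Lemma xspan_right_xM n i a :
  xspan_right n a -> xspan_right n (leavitt_x F i * a).
Proof.
elim: n a => [|n IHn] a /= Xa; last by move=> j; rewrite -mulrA; apply: IHn.
elim: Xa => {a} [u|a b _ IHa _ IHb|c a _ IHa].
- suff -> : leavitt_x F i * xword u = xword (i :: u) by constructor.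
  by rewrite /xword big_cons.
- by rewrite mulrDr; constructor.
- by rewrite -leavitt_scaleAr; constructor.
Qed.

(** The left factor [y_i] cancels the first letter of a word; when the word is empty, it cancels
    against the one additional right factor. *)
Lemma xspan_right_yM n i a :
  xspan_right n a -> xspan_right n.+1 (leavitt_y F i * a).
Proof.
elim: n a => [|n IHn] a Xa j; last by have := IHn _ (Xa j); rewrite mulrA.
rewrite /= in Xa *.
(* Zero, which arises when [y_i] meets a different letter, is 0 times the empty word. *)
have X0 : xspan 0 by rewrite -(scale0r (xword [::])); do 2!constructor.
have Xnat (b : bool) u : xspan (b%:R * xword u).
  by case: b; rewrite ?mul1r ?mul0r //; constructor.
elim: Xa => {a} [u|a b _ IHa _ IHb|c a _ IHa].
- case: u => [|k u].
    rewrite /xword big_nil mulr1 leavitt_yx -[_%:R]mulr1.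
    by have := Xnat (i == j) [::]; rewrite /xword big_nil.
  apply: xspan_Mx; rewrite /xword big_cons mulrA leavitt_yx; exact: Xnat.
- by rewrite mulrDr mulrDl; constructor.
- by rewrite -leavitt_scaleAr -leavitt_scaleAl; constructor.
Qed.

(** Induction on the construction of [a]: scalars and left factors [x_i] keep the length, a sum
    takes the larger one, and a left factor [y_i] raises it by one. *)
Lemma xspan_rightP a : exists n, xspan_right n a.
Proof.
elim/leavitt_ind: a.
- exists 0%N; have -> : 1 = xword [::] by rewrite /xword big_nil.
  exact: xspan_word.
- move=> a b [n Xa] [p Xb]; exists (maxn n p); apply: xspan_rightD.
    exact: xspan_right_leq (leq_maxl _ _) Xa.
  exact: xspan_right_leq (leq_maxr _ _) Xb.
- by move=> c a [n Xa]; exists n; apply: xspan_rightZ.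
- by move=> i a [n Xa]; exists n; apply: xspan_right_xM.
- by move=> i a [n Xa]; exists n.+1; apply: xspan_right_yM.
Qed.

(** If [phi a = 0], then [phi] also kills each [a * x_i]; these vanish by induction on the length,
    and [a] is the sum of the [(a * x_i) * y_i]. *)
Lemma leavitt_inj (A : pzRingType) (phi : {rmorphism L -> A}) :
  (forall a, xspan a -> phi a = 0 -> a = 0) -> injective phi.
Proof.
move=> phiX; suff phi0 n a : xspan_right n a -> phi a = 0 -> a = 0.
  move=> a b ab; have [n Xn] := xspan_rightP (a - b).
  by apply/subr0_eq/(phi0 n) => //; rewrite rmorphB ab subrr.
elim: n a => [|n IHn] a /= Xa a0; first exact: phiX.
rewrite -[a]mulr1 -leavitt_xy mulr_sumr big1 // => i _.
by rewrite mulrA (IHn (a * _)) ?mul0r // rmorphM a0 mul0r.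
Qed.
End XWords.

(** * Matrices satisfying the Leavitt relations *)

Section Matrices.
Variables (F : fieldType) (m : nat).
Implicit Types x : rcmx F.

Lemma eq_block (k l : nat) (i j : 'I_m) :
  (k * m + i == l * m + j)%N = (k == l) && (i == j).
Proof.
apply/eqP/andP => [/block_uniq[-> ->]|[/eqP-> /eqP->]//].
by rewrite !eqxx.
Qed.

Lemma block_ex (i : 'I_m) r : exists k (j : 'I_m), r = (k * m + j)%N.
Proof.
have m0 : (0 < m)%N by apply: leq_ltn_trans (ltn_ord i).
by exists (r %/ m)%N, (Ordinal (ltn_pmod r m0)); rewrite /= -divn_eq.
Qed.

Lemma rcmx_x_proof (i : 'I_m) :
  (fun r c => (r == c * m + i)%N%:R : F) \in @rcfin F.
Proof.
apply/rcfinP; split=> [r|c].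
  exists r.+1 => c rc; rewrite (ltn_eqF _) //.
  apply: leq_trans rc _; apply: leq_trans (leq_addr _ _).
  by rewrite leq_pmulr //; apply: leq_ltn_trans (ltn_ord i).
by exists (c * m + i).+1%N => r cr; rewrite gtn_eqF.
Qed.
(** On column vectors this is the map sending the basis vector [c] to the basis vector [c * m + i];
    [rcmx_y i] is its transpose. *)
Definition rcmx_x i := RCMx (rcmx_x_proof i).

Lemma rcmx_y_proof (i : 'I_m) :
  (fun r c => (c == r * m + i)%N%:R : F) \in @rcfin F.
Proof. by have /rcfinP[rx cx] := rcmx_x_proof i; apply/rcfinP. Qed.
Definition rcmx_y i := RCMx (rcmx_y_proof i).

Lemma rcmx_x_block i :
  @repeated_block F (m ^ 1) (m ^ 0) (\col_u (u == i)%:R) (rcmx_x i).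
Proof.
split=> [k u v|r c /=]; first by rewrite ord1 mxE /= muln1 addn0 eq_block eqxx.
have [-> _|_] := eqVneq r _; last by rewrite eqxx.
by exists c, i, ord0; rewrite /= muln1 addn0.
Qed.

Lemma rcmx_y_block i :
  @repeated_block F (m ^ 0) (m ^ 1) (\row_v (v == i)%:R) (rcmx_y i).
Proof.
split=> [k u v|r c /=]; first by rewrite ord1 mxE /= muln1 addn0 eq_block eqxx.
have [-> _|_] := eqVneq c _; last by rewrite eqxx.
by exists r, ord0, i; rewrite /= muln1 addn0.
Qed.

Lemma rcmx_xM (i j : 'I_m) x c s :
  (rcmx_x i * x) (c * m + j)%N s = (j == i)%:R * x c s :> F.
Proof.
rewrite rcmx_mulE (@rc_mulE _ _ _ _ _ c.+1) => [|d cd].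
  rewrite (bigD1 ord_max) //= eq_block eqxx big1 ?addr0 // => d.
  by rewrite -val_eqE /= eq_sym eq_block => /negPf ->; rewrite mul0r.
by rewrite /= eq_block (ltn_eqF cd).
Qed.

Lemma rcmx_yM i x r s : (rcmx_y i * x) r s = x (r * m + i)%N s.
Proof.
rewrite rcmx_mulE (@rc_mulE _ _ _ _ _ (r * m + i).+1) => [|d rd].
  rewrite (bigD1 ord_max) //= eqxx mul1r big1 ?addr0 // => d.
  by rewrite -val_eqE /= => /negPf ->; rewrite mul0r.
by rewrite /= gtn_eqF.
Qed.

Lemma rcmx_yx i j : rcmx_y i * rcmx_x j = (i == j)%:R.
Proof.
apply: rcmxP => r s; rewrite rcmx_yM /= eq_block andbC.
by case: (i == j); rewrite //= rcmx_oneE.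
Qed.

Lemma rcmx_sumE (I : Type) (l : seq I) (G : I -> rcmx F) r s :
  (\sum_(i <- l) G i) r s = \sum_(i <- l) G i r s.
Proof. exact: (big_morph (fun x : rcmx F => x r s)). Qed.

Lemma rcmx_xy : (0 < m)%N -> \sum_i rcmx_x i * rcmx_y i = 1.
Proof.
move=> m0; apply: rcmxP => r s; rewrite rcmx_sumE.
have [c [j ->]] := block_ex (Ordinal m0) r.
rewrite (bigD1 j) // rcmx_xM eqxx mul1r big1 => [|i /negPf ij].
  by rewrite [LHS]addr0 rcmx_oneE [LHS]/= eq_sym.
by rewrite rcmx_xM eq_sym ij mul0r.
Qed.

(** * Generation of the recurrent matrices *)

Lemma repeated_block_scalar x (a : 'M[F]_1) :
  repeated_block a x -> x = a ord0 ord0 *: 1.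
Proof.
move=> [xa x0]; apply: rcmxP => r c; rewrite rcmx_scaleE rcmx_oneE.
have [<-|rc] := eqVneq r c.
  by have := xa r ord0 ord0; rewrite muln1 addn0 mulr1.
rewrite mulr0; apply/eqP/negPn/negP => /x0[k [u [v []]]].
by rewrite !ord1 => rE cE; rewrite rE cE eqxx in rc.
Qed.

(** Left multiplication by the [rcmx_y i] shortens the block by a factor [m] until one row is left;
    then right multiplication by the [rcmx_x i] narrows it until it is 1 x 1, that is, a scalar
    matrix. *)
Lemma recurrent_ind (P : rcmx F -> Prop) : (0 < m)%N ->
  P 1 -> (forall x y, P x -> P y -> P (x + y)) ->
  (forall c x, P x -> P (c *: x)) ->
  (forall i x, P x -> P (rcmx_x i * x)) ->
  (forall i x, P x -> P (x * rcmx_y i)) ->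
  forall x, recurrent m x -> P x.
Proof.
move=> m0 P1 PD PZ Px Py x [p [q [a]]].
have P0 : P 0 by rewrite -(scale0r (1 : rcmx F)); apply: PZ.
elim: p x a => [|p IHp] x.
  elim: q x => [|q IHq] x a xa.
    by rewrite (repeated_block_scalar xa); apply: PZ.
  rewrite -[x]mulr1 -rcmx_xy // mulr_sumr; elim/big_ind: _ => // i _.
  rewrite mulrA; apply: Py.
  have mq : (0 < m ^ q)%N by rewrite expn_gt0 m0.
  (* Refining by [m ^ q] gives the block of [rcmx_x i] as many rows as [a] has columns. *)
  have [] := repeated_block_refine mq (rcmx_x_block i).
  rewrite -!expnD => b xb.
  by apply: (IHq _ (a *m b)); apply: repeated_blockM xa xb.
move=> a xa; rewrite -[x]mul1r -rcmx_xy // mulr_suml; elim/big_ind: _ => // i _.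
rewrite -mulrA; apply: Px.
have mp : (0 < m ^ p)%N by rewrite expn_gt0 m0.
have [] := repeated_block_refine mp (rcmx_y_block i).
rewrite -!expnD => b xb.
by apply: (IHp _ (b *m a)); apply: repeated_blockM xb xa.
Qed.

Lemma recurrent_x i : recurrent m (rcmx_x i).
Proof. by exists 1%N, 0%N, (\col_u (u == i)%:R); apply: rcmx_x_block. Qed.

Lemma recurrent_y i : recurrent m (rcmx_y i).
Proof. by exists 0%N, 1%N, (\row_u (u == i)%:R); apply: rcmx_y_block. Qed.

Definition rec_x i : rec_alg F m := RecAlg (rec_sums_recurrent (recurrent_x i)).
Definition rec_y i : rec_alg F m := RecAlg (rec_sums_recurrent (recurrent_y i)).

Lemma rec_yx i j : rec_y i * rec_x j = (i == j)%:R.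
Proof.
apply: val_inj; by rewrite [LHS]rcmx_yx; case: (i == j).
Qed.

Lemma rec_xy : (0 < m)%N -> \sum_i rec_x i * rec_y i = 1.
Proof.
move=> m0; apply: val_inj.
by rewrite raddf_sum [RHS]/= -[RHS](rcmx_xy m0).
Qed.

(* [x_u] maps the basis vector 1 to the basis vector whose index has the digits
   of [u] below the leading digit 1 in base m. *)
Definition word_index (u : seq 'I_m) :=
  foldr (fun (i : 'I_m) n => n * m + i)%N 1%N u.

(** Nonempty words have index above 1, the index of the empty word, and division by [m] recovers the
    first letter. For [m = 1] all indices would be 1. *)
Lemma word_index_inj : (1 < m)%N -> injective word_index.
Proof.
move=> m1.
have index_gt0 u : (0 < word_index u)%N.
  by elim: u => //= i u IHu; rewrite addn_gt0 muln_gt0 IHu ltnW.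
have index_gt1 i u : (1 < word_index (i :: u))%N.
  apply: leq_trans (leq_addr _ _); apply: leq_trans m1 _.
  by rewrite leq_pmull.
elim=> [|i u IHu] [|j v] // e.
- by have := index_gt1 j v; rewrite -e.
- by have := index_gt1 i u; rewrite e.
- by have [/IHu -> ->] := block_uniq e.
Qed.
End Matrices.

Section RecAlgEntries.
Variables (F : fieldType) (m : nat).
Implicit Types x y : rec_alg F m.

Lemma rec_algDE x y r s : (x + y : rec_alg F m) r s = x r s + y r s.
Proof. by []. Qed.

Lemma rec_algZE (c : F) x r s : (c *: x : rec_alg F m) r s = c * x r s.
Proof. by []. Qed.

Lemma rec_algME x y : (x * y : rec_alg F m) = (x : rcmx F) * y :> rcmx F.
Proof. by []. Qed.
End RecAlgEntries.

(** * Injectivity and surjectivity *)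

Section Isomorphism.
Variables (F : fieldType) (m : nat) (m1 : (1 < m)%N).
Variable phi : {rmorphism leavitt F m -> rec_alg F m}.
Hypothesis phiZ : scalable phi.
Hypothesis phi_x : forall i, phi (leavitt_x F i) = rec_x F i.
Hypothesis phi_y : forall i, phi (leavitt_y F i) = rec_y F i.

(** Multiplying on the left by [rcmx_x i] moves row [n] to row [n * m + i], which is the recursion
    of [word_index]. *)
Lemma phi_word u r :
  (phi (xword F u) : rcmx F) r 1%N = (r == word_index u)%:R.
Proof.
elim: u r => [|i u IHu] r.
  by rewrite /xword big_nil rmorph1.
have -> : xword F (i :: u) = leavitt_x F i * xword F u.
  by rewrite /xword big_cons.
rewrite rmorphM phi_x rec_algME; have [c [j ->]] := block_ex i r.
rewrite [LHS]rcmx_xM IHu /= eq_block andbC.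
by case: (j == i); rewrite ?mul1r ?mul0r.
Qed.

Lemma phi_xspan_inj a : xspan a -> phi a = 0 -> a = 0.
Proof.
(* [w] decodes an index into its word. The default for an index of no word is harmless, since its
   coefficient is 0 for [a] in the span. *)
pose w r := xword F (xget [::] [set u | @word_index m u = r]%classic).
have wE u : w (word_index u) = xword F u.
  rewrite /w; congr (xword F _); apply: (word_index_inj m1).
  exact: (@xgetI _ [::] [set v | word_index v = word_index u]%classic u).
(* Asking for all [n] from some [N] on lets two summands share a bound. *)
suff decode : xspan a -> exists N, forall n, (N <= n)%N ->
    a = \sum_(r < n) (phi a : rcmx F) r 1%N *: w r.
  move=> /decode[N aE] a0; rewrite (aE N) // big1 // => r _.
  by rewrite a0 scale0r.
elim=> {a} [u|a b _ [N aE] _ [N' bE]|c a _ [N aE]].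
- exists (word_index u).+1 => n un; rewrite (bigD1 (Ordinal un)) //=.
  rewrite phi_word eqxx scale1r wE big1 ?addr0 // => r.
  by rewrite -val_eqE phi_word /= => /negPf ->; rewrite scale0r.
- exists (maxn N N') => n; rewrite geq_max => /andP[Nn N'n].
  rewrite {1}(aE _ Nn) {1}(bE _ N'n) -big_split; apply: eq_bigr => r _.
  by rewrite rmorphD rec_algDE [RHS]scalerDl.
- exists N => n Nn; rewrite {1}(aE _ Nn) scaler_sumr; apply: eq_bigr => r _.
  by rewrite phiZ rec_algZE scalerA.
Qed.

Lemma phi_surj y : exists z, phi z = y.
Proof.
(* The claim is moved to the underlying matrices, where [recurrent_ind] applies to each summand. *)
suff [z zy] : exists z, phi z = y :> rcmx F by exists z; apply: val_inj.
have PD (x1 x2 : rcmx F) : (exists z, phi z = x1 :> rcmx F) ->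
    (exists z, phi z = x2 :> rcmx F) -> exists z, phi z = x1 + x2 :> rcmx F.
  by move=> [z1 <-] [z2 <-]; exists (z1 + z2); rewrite rmorphD.
have [s [sP ->]] := asboolP _ (valP y).
rewrite big_seq; elim/big_ind: _ => [||x0 /sP]; [|exact: PD|].
  by exists 0; rewrite rmorph0.
apply: (@recurrent_ind F m (fun x => exists z, phi z = x :> rcmx F)) => //.
- exact: ltnW.
- by exists 1; rewrite rmorph1.
- by move=> c x [z <-]; exists (c *: z); rewrite phiZ.
- by move=> i x [z <-]; exists (leavitt_x F i * z); rewrite rmorphM phi_x.
- by move=> i x [z <-]; exists (z * leavitt_y F i); rewrite rmorphM phi_y.
Qed.
End Isomorphism.

Theorem theorem5p4 (F : fieldType) (m : nat) (hm : (1 < m)%N) :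
  exists phi : {rmorphism leavitt F m -> rec_alg F m},
    scalable phi /\ bijective phi.
Proof.
have [phi [phiZ phi_x phi_y]] :=
  leavitt_lift (@rec_yx F m) (rec_xy F (ltnW hm)).
exists phi; split=> //.
(* Choosing preimages gives a right inverse; injectivity makes it a left inverse too. *)
have [psi phiK] := choice (phi_surj hm phiZ phi_x phi_y).
exists psi => // z; apply: (leavitt_inj (phi_xspan_inj hm phiZ phi_x)).
exact: phiK.
Qed.
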